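(* Let $P(\lambda)$ be a matrix polynomial with coefficients in $\mathbb{C}^{n\times n}$ having a realisation $$P(\lambda)=I+\lambda C(I-\lambda A)^{-1}B,$$ where $A\in\mathbb{C}^{d\times d}$, $B\in\mathbb{C}^{d\times n}$, $C\in\mathbb{C}^{n\times d}$, $A$ is strictly upper-triangular and $A-BC$ is lower-triangular. If $$\|CB\|_F^2+\operatorname{Re}\operatorname{tr}\bigl((BC)\odot(BC)\bigr)\ \ge\ \operatorname{tr}\bigl((C^*C)\odot(BB^* )\bigr)+\operatorname{Re}\operatorname{tr}\bigl((BC)^2\bigr),$$ then $$\|P(\lambda)\|_F\le n^{\frac d2}\exp\Bigl(\frac1n\operatorname{tr}\operatorname{Re}(\lambda CB)+\frac1{2n}\bigl(\|CB\|_F^2-2\operatorname{tr}\operatorname{Re}(CAB)\bigr)|\lambda|^2\Bigr)\qquad\text{for all }\lambda\in\mathbb{C}.$$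
   Context: $X\odot Y$ denotes the Hadamard (entrywise) product of matrices. For a square matrix $X$, $\operatorname{Re}X=\frac12(X+X^* )$; $\|X\|_F=\sqrt{\operatorname{tr}(X^*X)}$ is the Frobenius norm. *)

(* Defs.v *)
From mathcomp Require Import all_boot all_order all_algebra.
From mathcomp Require Import complex.
From mathcomp Require Import reals.
Set Implicit Arguments.
Unset Strict Implicit.
Unset Printing Implicit Defensive.
Import Order.TTheory GRing.Theory Num.Theory.
Local Open Scope ring_scope.
Local Open Scope sesquilinear_scope.
Local Open Scope complex_scope.

Definition hadamard (R : pzRingType) (m n : nat) (X Y : 'M[R]_(m, n)) :
  'M[R]_(m, n) := map2_mx *%R X Y.

Definition mxRe (R : realType) (n : nat) (X : 'M[R[i]]_n) : 'M[R[i]]_n :=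
  2^-1 *: (X + X ^t*).

(* The trace lies in R[i] but is a nonnegative real (see [fnormE]); [Re] brings
   it back to R. *)
Definition fnorm (R : realType) (m n : nat) (X : 'M[R[i]]_(m, n)) : R :=
  Num.sqrt (complex.Re (\tr (X ^t* *m X))).

Definition strictly_upper_mx (R : pzRingType) (d : nat) (X : 'M[R]_d) : Prop :=
  forall i j : 'I_d, (j <= i)%N -> X i j = 0.

Lemma fnormE (R : realType) (m n : nat) (X : 'M[R[i]]_(m, n)) :
  (fnorm X ^+ 2)%:C = \tr (X ^t* *m X).
Proof.
have tr_ge0 : 0 <= \tr (X ^t* *m X).
  apply: sumr_ge0 => i _; rewrite mxE; apply: sumr_ge0 => j _.
  by rewrite !mxE mulrC mul_conjC_ge0.
have := tr_ge0; rewrite /fnorm.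
case: (\tr _) => a b; rewrite lecE /= => /andP[/eqP -> a_ge0].
by rewrite sqr_sqrtr.
Qed.

(* The next two lemmas justify taking [Re] of these traces: they are real. *)
Lemma Im_tr_mxRe (R : realType) (n : nat) (X : 'M[R[i]]_n) :
  complex.Im (\tr (mxRe X)) = 0.
Proof.
suff /complex_realP[k ->] : \tr (mxRe X) \is Num.real; first by [].
rewrite /mxRe mxtraceZ mxtraceD realM ?realV ?realn //.
have -> : \tr (X ^t*) = (\tr X)^*%C.
  by rewrite /mxtrace rmorph_sum; apply: eq_bigr => i _; rewrite !mxE.
by case: (\tr X) => a b; rewrite complex_real /= subrr.
Qed.

Lemma Im_tr_hadamard_gram (R : realType) (d n : nat)
    (B : 'M[R[i]]_(d, n)) (C : 'M[R[i]]_(n, d)) :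
  complex.Im (\tr (hadamard (C ^t* *m C) (B *m B ^t*))) = 0.
Proof.
suff /ger0_real/complex_realP[k ->] :
  0 <= \tr (hadamard (C ^t* *m C) (B *m B ^t*)); first by [].
apply: sumr_ge0 => i _; rewrite !mxE.
apply: mulr_ge0; apply: sumr_ge0 => j _; rewrite !mxE.
  by rewrite mulrC mul_conjC_ge0.
by rewrite mul_conjC_ge0.
Qed.

(* Main.v *)
Require Import Defs.
From mathcomp Require Import all_boot all_order all_algebra.
From mathcomp Require Import complex.
From mathcomp Require Import reals sequences exp.
From mathcomp Require Import ring.
Import Order.TTheory GRing.Theory Num.Theory.
Local Open Scope ring_scope.
Local Open Scope sesquilinear_scope.

(** Write [c_k] for the columns of [C] and [b_k] for the rows of [B]. The
    triangularity hypotheses force [A] to be the strictly upper triangular part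
    of [B *m C], so [A i j] is [b_i c_j] for [i < j], and the realisation then
    telescopes into a product of [d] rank-one perturbations of the identity
    ([state_space_factorisation]):
      [P(lam) = (I + lam c_0 b_0) ... (I + lam c_(d-1) b_(d-1))].

    The Frobenius norm is submultiplicative ([fnormM]), and each factor has an
    explicit norm ([fnorm_1D_rank1_sqr]): with [N] the size of [P],
      [|I + lam c b|^2 = N + x],  [x = 2 Re (lam b c) + |lam|^2 |c|^2 |b|^2],
    which [1 + y <= exp y] bounds by [N exp (x / N)]. Multiplying over [k] yields
    the factor [N^d] and the exponential of the sum of the [x_k / N]. In that
    sum the [b_k c_k] add up to [tr (C B)], and the [|c_k|^2 |b_k|^2] to the
    trace of the Hadamard product of [C^* C] and [B B^*].

    Finally, as [A] is the strictly upper part of [G = B C], the trace of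
    [G^2] is that of the Hadamard square of [G] plus [2 tr (A G)]
    ([tr_sqr_strict_upper]), so the assumed inequality says precisely that
    the sum of the [|c_k|^2 |b_k|^2] is at most
    [|C B|^2 - 2 Re tr (C A B)]. *)

(** * Realisations with triangular data *)

Lemma telescope_prodr_ord {S : pzRingType} {d : nat} {E : 'I_d -> S}
    {Q : nat -> S} :
  (forall k : 'I_d, Q k = E k * Q k.+1) -> Q 0%N = (\prod_(k < d) E k) * Q d.
Proof.
elim: d => [|d IHd] in E *; first by rewrite big_ord0 mul1r.
move=> stepQ; rewrite big_ord_recr /= -mulrA -(stepQ ord_max).
by apply: IHd => k; apply: (stepQ (widen_ord (leqnSn d) k)).
Qed.

(** The state [Y = (I - lam A)^-1 B] solves [Y = B + lam A Y], a triangular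
    system which back substitution solves from the last row upwards. Since
    [A k j = b_k c_j] for [j > k], its [k]-th row is [b_k Q_(k+1)], where [Q_k]
    is the transfer function [I + lam (c_k y_k + c_(k+1) y_(k+1) + ...)] of
    the states from [k] on. Thus [Q_k = (I + lam c_k b_k) Q_(k+1)]. *)
Lemma state_space_factorisation {F : fieldType} {n d : nat} (lam : F)
    {A : 'M[F]_d} {B : 'M[F]_(d, n.+1)} {C : 'M[F]_(n.+1, d)} :
  strictly_upper_mx A -> is_trig_mx (A - B *m C) ->
  1%:M + lam *: (C *m invmx (1%:M - lam *: A) *m B) =
  \prod_(k < d) (1 + lam *: (col k C *m row k B)).
Proof.
move=> hA /is_trig_mxP hL.
have A_unit : 1%:M - lam *: A \in unitmx.
  have trig : is_trig_mx (1%:M - lam *: A)^T.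
    apply/is_trig_mxP => i j ij; rewrite !mxE hA 1?ltnW // mulr0 subr0.
    by rewrite -val_eqE gtn_eqF.
  rewrite unitmxE -det_tr (det_trig trig) big1 ?unitr1 // => i _.
  by rewrite !mxE eqxx hA // mulr0 subr0.
pose Y := invmx (1%:M - lam *: A) *m B.
have YE : Y = B + lam *: (A *m Y).
  have := mulKVmx A_unit B; rewrite -/Y mulmxBl mul1mx -scalemxAl => /eqP.
  by rewrite subr_eq => /eqP.
pose Q (k : nat) :=
  1%:M + lam *: \sum_(j < d | (k <= j)%N) (col j C *m row j Y).
have rowY (k : 'I_d) : row k Y = row k B *m Q k.+1.
  rewrite {1}YE linearD linearZ /= mulmxDr mulmx1 -scalemxAr.
  congr (_ + _ *: _).
  rewrite row_mul mulmx_sum_row mulmx_sumr.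
  rewrite (bigID (fun j : 'I_d => (k < j)%N)) /=.
  rewrite [X in _ + X]big1 => [|j]; last first.
    by rewrite -leqNgt => jk; rewrite mxE hA // scale0r.
  rewrite addr0; apply: eq_bigr => j kj.
  rewrite mulmxA; apply/rowP => l; rewrite !mxE big_ord1 !mxE; congr (_ * _).
  have /eqP := hL _ _ kj; rewrite !mxE subr_eq0 => /eqP ->.
  by apply: eq_bigr => m _; rewrite !mxE.
have stepQ (k : 'I_d) : Q k = (1 + lam *: (col k C *m row k B)) * Q k.+1.
  rewrite mulrDl mul1r -[_ * Q k.+1]/(_ *m _) -scalemxAl -mulmxA -rowY.
  rewrite /Q (bigD1 k) //= scalerDr [lam *: _ + _]addrC addrA.
  do 2!congr (_ + _); congr (_ *: _); apply: eq_bigl => j.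
  by rewrite ltn_neqAle eq_sym andbC.
have Qd : Q d = 1.
  by rewrite /Q big1 ?scaler0 ?addr0 // => j; rewrite leqNgt ltn_ord.
have -> : 1%:M + lam *: (C *m invmx (1%:M - lam *: A) *m B) = Q 0%N.
  rewrite -mulmxA -/Y /Q /=; congr (_ + _ *: _); apply/matrixP => i j.
  rewrite summxE mxE; apply: eq_bigr => k _.
  by rewrite [RHS]mxE big_ord1 !mxE.
by rewrite (telescope_prodr_ord stepQ) Qd mulr1.
Qed.

(** The trace of [G^2] is the sum of all [G i j * G j i]: the diagonal pairs form
    the Hadamard square, and the others come in equal halves, one for [i < j],
    where [G i j = A i j], and one for [j < i]. *)
Lemma tr_sqr_strict_upper {S : comPzRingType} {d : nat} {A G : 'M[S]_d} :
  strictly_upper_mx A -> is_trig_mx (A - G) ->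
  \tr (G *m G) = \tr (hadamard G G) + \tr (A *m G) *+ 2.
Proof.
move=> hA /is_trig_mxP hL.
have AG (i j : 'I_d) : (i < j)%N -> A i j = G i j.
  by move=> ij; have /eqP := hL _ _ ij; rewrite !mxE subr_eq0 => /eqP.
have trM (X Y : 'M[S]_d) : \tr (X *m Y) = \sum_i \sum_j X i j * Y j i.
  by apply: eq_bigr => i _; rewrite mxE.
have -> : \tr (hadamard G G) =
    \sum_i \sum_j (if j == i then G i j * G j i else 0).
  by apply: eq_bigr => i _; rewrite -big_mkcond big_pred1_eq mxE.
have trAG : \tr (A *m G) = \sum_i \sum_j A j i * G i j.
  by rewrite trM exchange_big.
(* One copy of [tr (A G)] covers the pairs below the diagonal, the other those
   above it. *)
rewrite mulr2n {1}trAG !trM -!big_split /=; apply: eq_bigr => i _.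
rewrite -!big_split /=; apply: eq_bigr => j _.
case: (ltngtP i j) => [ij|ji|/val_inj <-].
- rewrite -val_eqE /= gtn_eqF // (AG _ _ ij).
  by rewrite (hA j i) ?(ltnW ij) // mul0r !add0r.
- rewrite -val_eqE /= ltn_eqF // (AG _ _ ji).
  by rewrite (hA i j) ?(ltnW ji) // mul0r addr0 add0r mulrC.
- by rewrite eqxx hA // mul0r !addr0.
Qed.

(** * The Frobenius norm *)

Section Frobenius.
Context {R : realType}.
Local Open Scope complex_scope.

Lemma real_complexM (x y : R) : (x * y)%:C = x%:C * y%:C.
Proof. exact: rmorphM. Qed.

Lemma real_complexD (x y : R) : (x + y)%:C = x%:C + y%:C.
Proof. exact: rmorphD. Qed.

Lemma Re_add (x y : R[i]) : complex.Re (x + y) = complex.Re x + complex.Re y.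
Proof. by case: x y => [? ?] [? ?]. Qed.

Lemma Re_sum {I : finType} (F : I -> R[i]) :
  complex.Re (\sum_i F i) = \sum_i complex.Re (F i).
Proof. exact: (raddf_sum (@complex.Re R : Rcomplex R -> R)). Qed.

Lemma fnorm_sqr_sum {m n} (X : 'M[R[i]]_(m, n)) :
  (fnorm X ^+ 2)%:C = \sum_i \sum_j `|X i j| ^+ 2.
Proof.
rewrite fnormE exchange_big; apply: eq_bigr => j _; rewrite mxE.
by apply: eq_bigr => i _; rewrite !mxE normCKC.
Qed.

(** Entrywise Cauchy-Schwarz, [|(X Y) i k|^2 <= |row i X|^2 |col k Y|^2]; summing
    over [i] and [k] turns the right-hand side into a product of two sums. *)
Lemma fnormM {m n p} (X : 'M[R[i]]_(m, n)) (Y : 'M[R[i]]_(n, p)) :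
  fnorm (X *m Y) <= fnorm X * fnorm Y.
Proof.
rewrite -(@ler_pXn2r _ 2) ?nnegrE ?mulr_ge0 ?sqrtr_ge0 // exprMn.
rewrite -lecR [leRHS]real_complexM !fnorm_sqr_sum [X in _ * X]exchange_big.
rewrite mulr_suml; apply: ler_sum => i _.
rewrite mulr_sumr; apply: ler_sum => k _.
have dot_self (u : 'rV[R[i]]_n) : dotmx u u = \sum_j `|u 0 j| ^+ 2.
  by rewrite dotmxE mxE; apply: eq_bigr => j _; rewrite !mxE normCK.
have [CS _] := CauchySchwarz (@dotmx _ n) (row i X) ((col k Y) ^t*).
move: CS.
rewrite /= !dot_self dotmxE.
have -> : (row i X *m (col k Y) ^t* ^t*) 0 0 = (X *m Y) i k.
  by rewrite !mxE; apply: eq_bigr => j _; rewrite !mxE conjCK.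
have -> : \sum_j `|row i X 0 j| ^+ 2 = \sum_j `|X i j| ^+ 2.
  by apply: eq_bigr => j _; rewrite mxE.
have -> // : \sum_j `|(col k Y ^t*) 0 j| ^+ 2 = \sum_j `|Y j k| ^+ 2.
by apply: eq_bigr => j _; rewrite !mxE norm_conjC.
Qed.

(** Nonemptiness matters: the empty product has norm [sqrt n.+1], not [1]. *)
Lemma fnorm_prod {n d : nat} (E : 'I_d -> 'M[R[i]]_n.+1) :
  (0 < d)%N -> fnorm (\prod_(k < d) E k) <= \prod_(k < d) fnorm (E k).
Proof.
case: d => // d in E *; move=> _.
elim: d => [|d IHd] in E *; first by rewrite !big_ord1.
rewrite big_ord_recl [leRHS]big_ord_recl.
apply: (le_trans (fnormM _ _)); apply: ler_wpM2l; first exact: sqrtr_ge0.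
exact: IHd.
Qed.

(** Expand [tr ((I + lam c b)^* (I + lam c b))]: the two cross terms are
    conjugate, hence twice a real part, and the quadratic term is
    [|lam|^2 |c|^2 |b|^2] by cyclicity of the trace. *)
Lemma fnorm_1D_rank1_sqr {n} (lam : R[i]) (c : 'cV[R[i]]_n) (b : 'rV[R[i]]_n) :
  fnorm (1%:M + lam *: (c *m b)) ^+ 2 =
  n%:R + 2 * complex.Re (lam * (b *m c) 0 0)
  + complex.Re `|lam| ^+ 2 * complex.Re ((c ^t* *m c) 0 0 * (b *m b ^t*) 0 0).
Proof.
apply: complexI; rewrite fnormE.
have adj : (1%:M + lam *: (c *m b)) ^t* = 1%:M + lam^* *: (b ^t* *m c ^t*).
  rewrite linearD /= map_mxD trmx1 map_mx1.
  by rewrite linearZ /= map_mxZ trmx_mul map_mxM.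
rewrite adj mulmxDl mul1mx mulmxDr mulmx1 !linearD /= !mxtraceZ.
have -> : \tr (lam^* *: (b ^t* *m c ^t*) *m (lam *: (c *m b))) =
    `|lam| ^+ 2 * ((c ^t* *m c) 0 0 * (b *m b ^t*) 0 0).
  rewrite -scalemxAl -scalemxAr !mxtraceZ mulrA -normCKC; congr (_ * _).
  rewrite mulmxA -(mulmxA (b ^t*)) [c ^t* *m c]mx11_scalar mul_mx_scalar.
  by rewrite -scalemxAl mxtraceZ mxtrace_mulC trace_mx11
            [_%:M _ _]mxE eqxx mulr1n.
set w := (c ^t* *m c) 0 0 * _.
have w_real : (complex.Re w)%:C = w.
  apply/RRe_real/ger0_real; rewrite /w.
  apply: mulr_ge0; rewrite mxE; apply: sumr_ge0 => i _.
    by rewrite !mxE mulrC mul_conjC_ge0.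
  by rewrite !mxE mul_conjC_ge0.
have lam_real : (complex.Re `|lam|)%:C = `|lam| by [].
have trE : \tr (b ^t* *m c ^t*) = ((b *m c) 0 0)^*.
  by rewrite mxtrace_mulC trace_mx11 -map_mxM -trmx_mul mxE mxE.
have twoRe (x : R[i]) : (2 * complex.Re x)%:C = x + x^*.
  by rewrite real_complexM [RHS]addcJ [2%:C]rmorph_nat.
rewrite [X in _ = X]real_complexD [X in _ = X + _]real_complexD twoRe.
rewrite real_complexM real_complexM lam_real w_real.
rewrite mxtrace1 trE [\tr (c *m b)]mxtrace_mulC trace_mx11 rmorphM.
by rewrite [n%:R%:C]rmorph_nat !addrA.
Qed.

Lemma fnorm_1D_rank1_sqr_le {n} (lam : R[i]) (c : 'cV[R[i]]_n.+1)
    (b : 'rV[R[i]]_n.+1) :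
  fnorm (1%:M + lam *: (c *m b)) ^+ 2 <=
  n.+1%:R * expR ((2 * complex.Re (lam * (b *m c) 0 0)
    + complex.Re `|lam| ^+ 2 * complex.Re ((c ^t* *m c) 0 0 * (b *m b ^t*) 0 0))
    / n.+1%:R).
Proof.
rewrite fnorm_1D_rank1_sqr -addrA; set x := _ + _ * _.
apply: le_trans (ler_wpM2l (ler0n _ _) (expR_ge1Dx _)).
by rewrite mulrDr mulr1 mulrCA divff ?mulr1 // pnatr_eq0.
Qed.

Lemma Re_tr_mxRe {n} (X : 'M[R[i]]_n) :
  complex.Re (\tr (mxRe X)) = complex.Re (\tr X).
Proof.
rewrite /mxRe mxtraceZ mxtraceD.
have -> : \tr (X ^t*) = (\tr X)^*%C.
  by rewrite /mxtrace rmorph_sum; apply: eq_bigr => i _; rewrite !mxE.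
by rewrite [_ + _]addcJ mulKf ?pnatr_eq0.
Qed.

End Frobenius.

(** * The growth bound *)

Theorem theorem5p2 (R : realType) (n d : nat) (hd : (0 < d)%N)
    (P : {poly 'M[R[i]]_n.+1})
    (A : 'M[R[i]]_d) (B : 'M[R[i]]_(d, n.+1)) (C : 'M[R[i]]_(n.+1, d))
    (hP : forall lam : R[i],
      P.[lam%:M] = 1%:M + lam *: (C *m invmx (1%:M - lam *: A) *m B))
    (hA : strictly_upper_mx A)
    (hL : is_trig_mx (A - B *m C))
    (hineq :
      fnorm (C *m B) ^+ 2 + complex.Re (\tr (hadamard (B *m C) (B *m C)))
      >= complex.Re (\tr (hadamard (C ^t* *m C) (B *m B ^t*)))
         + complex.Re (\tr ((B *m C) ^+ 2))) :
  forall lam : R[i],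
    fnorm P.[lam%:M] <=
      (n.+1%:R `^ (d%:R / 2)) *
      expR (n.+1%:R^-1 * complex.Re (\tr (mxRe (lam *: (C *m B))))
            + (2 * n.+1%:R)^-1
              * (fnorm (C *m B) ^+ 2
                 - 2 * complex.Re (\tr (mxRe (C *m A *m B))))
              * (complex.Re `|lam|) ^+ 2).
Proof.
move=> lam.
set N : R := n.+1%:R; set L := complex.Re `|lam|.
set t := _ + _.
have N_gt0 : 0 < N by rewrite ltr0n.
(* [x k] is the excess of the squared norm of the [k]-th factor over [N]. *)
pose x (k : 'I_d) : R := 2 * complex.Re (lam * (row k B *m col k C) 0 0)
  + L ^+ 2 * complex.Re (((col k C) ^t* *m col k C) 0 0
                         * (row k B *m (row k B) ^t*) 0 0).
have sum_x : \sum_k x k = 2 * complex.Re (lam * \tr (B *m C))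
    + L ^+ 2 * complex.Re (\tr (hadamard (C ^t* *m C) (B *m B ^t*))).
  rewrite big_split /= -!mulr_sumr -!Re_sum -mulr_sumr.
  congr (_ * complex.Re (_ * _) + _ * complex.Re _); apply: eq_bigr => k _.
    by rewrite !mxE; apply: eq_bigr => j _; rewrite !mxE.
  by rewrite !mxE; congr (_ * _); apply: eq_bigr => j _; rewrite !mxE.
have x_le_t : \sum_k x k / N <= t *+ 2.
  have trCAB : complex.Re (\tr ((B *m C) ^+ 2)) =
      complex.Re (\tr (hadamard (B *m C) (B *m C)))
      + 2 * complex.Re (\tr (C *m A *m B)).
    have -> : (B *m C) ^+ 2 = B *m C *m (B *m C) by rewrite expr2.
    rewrite (tr_sqr_strict_upper hA hL) mulr2n !Re_add mulr2n mulrDl mul1r.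
    by rewrite mulmxA mxtrace_mulC mulmxA.
  rewrite -mulr_suml sum_x /t !Re_tr_mxRe mxtraceZ [\tr (C *m B)]mxtrace_mulC.
  move: hineq; rewrite trCAB addrCA [leRHS]addrC lerD2l -lerBrDr => W_le.
  set r := complex.Re (lam * _).
  have -> : (N^-1 * r + (2 * N)^-1 * (fnorm (C *m B) ^+ 2
      - 2 * complex.Re (\tr (C *m A *m B))) * L ^+ 2) *+ 2 =
      (2 * r + L ^+ 2 * (fnorm (C *m B) ^+ 2
                         - 2 * complex.Re (\tr (C *m A *m B)))) / N.
    by field; rewrite nat1r pnatr_eq0.
  by rewrite ler_pM2r ?invr_gt0 // lerD2l ler_wpM2l ?sqr_ge0.
have sqr_le : fnorm P.[lam%:M] ^+ 2 <= N ^+ d * expR (t *+ 2).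
  rewrite hP state_space_factorisation //.
  apply: (@le_trans _ _
      ((\prod_(k < d) fnorm (1 + lam *: (col k C *m row k B))) ^+ 2)).
    rewrite ler_pXn2r ?nnegrE ?sqrtr_ge0 ?prodr_ge0 ?fnorm_prod // => k _.
    exact: sqrtr_ge0.
  rewrite -prodrXl; apply: (@le_trans _ _ (\prod_(k < d) (N * expR (x k / N)))).
    apply: ler_prod => k _; rewrite exprn_ge0 ?sqrtr_ge0 //=.
    exact: fnorm_1D_rank1_sqr_le.
  rewrite big_split /= prodr_const card_ord -expR_sum ler_pM2l ?exprn_gt0 //.
  by rewrite ler_expR.
rewrite -(@ler_pXn2r _ 2) ?nnegrE ?sqrtr_ge0 ?mulr_ge0 ?powR_ge0 ?expR_ge0 //.
apply: le_trans sqr_le _.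
rewrite exprMn -expRM_natr mulr_natr.
rewrite -[(_ `^ _) ^+ 2]powR_mulrn ?powR_ge0 // -powRrM divfK ?pnatr_eq0 //.
by rewrite (powR_mulrn _ (ltW N_gt0)).
Qed.
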